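(* Let $\alpha\ge 1$ be real and $n\le 5$. Then for every positive semi-definite Hermitian $A=(a_{i,j})\in M_n(\mathbb C)$, $$\operatorname{per}_\alpha A\ge\alpha^n\prod_{i=1}^n a_{ii}\ge(-1)^n\operatorname{per}_{-\alpha}A.$$
   Context: For $A=(a_{i,j})\in M_n(\mathbb C)$ and a number $\alpha$, $\operatorname{per}_\alpha A=\sum_{\pi\in\mathfrak S_n}\alpha^{\nu(\pi)}\prod_{i=1}^n a_{i,\pi(i)}$, where $\mathfrak S_n$ is the symmetric group and $\nu(\pi)$ is the number of disjoint cycles of $\pi$ (fixed points counted). *)

(* Defs.v *)
From HB Require Import structures.
From mathcomp Require Import all_boot all_order all_algebra.
From mathcomp Require Import perm.
Set Implicit Arguments. Unset Strict Implicit. Unset Printing Implicit Defensive.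
Import Order.TTheory GRing.Theory Num.Theory.
Local Open Scope ring_scope.

(* nu(pi) = number of disjoint cycles of pi, fixed points counted:
   the number of orbits of the permutation (porbits includes singletons). *)
Definition ncycles (n : nat) (s : 'S_n) : nat := #|porbits s|.

Definition per_alpha (C : numClosedFieldType) (n : nat) (alpha : C)
  (A : 'M[C]_n) : C :=
  \sum_(s : 'S_n) alpha ^+ ncycles s * \prod_(i < n) A i (s i).

Definition hermitian_mx (C : numClosedFieldType) (n : nat) (A : 'M[C]_n) : Prop :=
  forall i j, A j i = (A i j)^*.

Definition psd_mx (C : numClosedFieldType) (n : nat) (A : 'M[C]_n) : Prop :=
  forall x : 'cV[C]_n, 0 <= \sum_(i < n) \sum_(j < n) (x i 0)^* * A i j * x j 0.

(* Main.v *)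
Require Import Defs.
From HB Require Import structures.
From mathcomp Require Import all_boot all_order all_algebra.
From mathcomp Require Import fingroup perm spectral sesquilinear ring.
Import Order.TTheory GRing.Theory Num.Theory.
Local Open Scope ring_scope.
Set Implicit Arguments. Unset Strict Implicit. Unset Printing Implicit Defensive.

(** Both inequalities say [0 <= eps (eps^n per_(eps alpha) A - alpha^n prod A_ii)],
    for [eps = 1] and [eps = -1], and by scaling one may assume [A_ii = 1].
    At [alpha = 1] this is the theorem of Marcus ([per A >= prod A_ii]) and of
    Hadamard ([det A <= prod A_ii]), valid for all [n]: the permutations fixing
    a set [F] and moving a further index [x] contribute a Hermitian square.
    Write [T], [C3], [T2], [C4], [C32] for the sums over the transpositions, the
    3-cycles, the double transpositions, the 4-cycles and the permutations of
    type (3,2). For [n = 5] and [alpha = 1 + t], the quantity is [alpha] times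
    the sum of its value at [alpha = 1] and of [t D], where
      [D = (3 + 3t + t^2) T + eps (2 + t) (C3 + T2) + C4 + C32].
    For [eps = 1], [D >= 0] follows from the case [alpha = 1] of the five
    4 x 4 principal minors and from [T + 2 C3 >= 0] for 3 x 3 minors; for
    [eps = -1] it follows from Fischer's inequality on the 4 x 4 minors, from
    the positivity of the 3 x 3 minors, and from [C3 <= 2 T], [T2 <= 3/2 T]. *)

(** * Removing an index from a permutation *)

Lemma lift_permX (n k : nat) (s : 'S_n) (x : 'I_n) :
  ((lift_perm ord0 ord0 s) ^+ k)%g (lift ord0 x) = lift ord0 ((s ^+ k)%g x).
Proof.
by elim: k => [|k IHk]; rewrite ?expg0 ?perm1 // !expgSr !permM IHk lift_perm_lift.
Qed.

Lemma porbit_lift_perm (n : nat) (s : 'S_n) (x : 'I_n) :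
  porbit (lift_perm ord0 ord0 s) (lift ord0 x) = lift ord0 @: porbit s x.
Proof.
apply/setP=> y; apply/porbitP/imsetP => [[k ->]|[z /porbitP[k ->] ->]].
  by exists ((s ^+ k)%g x); rewrite ?mem_porbit ?lift_permX.
by exists k; rewrite lift_permX.
Qed.

Lemma porbit_lift_perm0 (n : nat) (s : 'S_n) :
  porbit (lift_perm ord0 ord0 s) ord0 = [set ord0].
Proof.
apply/setP=> y; rewrite inE; apply/porbitP/eqP => [[k ->]|->]; last first.
  by exists 0%N; rewrite perm1.
by elim: k => [|k IHk]; rewrite ?perm1 // expgSr permM IHk lift_perm_id.
Qed.

(** The orbits are the lifted orbits of [s] together with the new singleton of [ord0]. *)
Lemma ncycles_lift_perm (n : nat) (s : 'S_n) :
  ncycles (lift_perm ord0 ord0 s) = (ncycles s).+1.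
Proof.
rewrite /ncycles; pose L (X : {set 'I_n}) : {set 'I_n.+1} := lift ord0 @: X.
have -> : porbits (lift_perm ord0 ord0 s) = [set ord0] |: L @: porbits s.
  apply/setP=> X; rewrite in_setU1; apply/imsetP/orP => [[x _ ->]|].
    case: (unliftP ord0 x) => [y|] ->.
      by right; rewrite porbit_lift_perm; apply/imset_f/imset_f.
    by left; rewrite porbit_lift_perm0.
  case=> [/eqP->|/imsetP[Y /imsetP[x _ ->] ->]].
    by exists ord0; rewrite ?porbit_lift_perm0.
  by exists (lift ord0 x); rewrite ?porbit_lift_perm.
rewrite cardsU1 card_imset; last exact: imset_inj lift_inj.
case: imsetP => // -[X _ /setP/(_ ord0)]; rewrite inE eqxx => /esym/imsetP[x _].
by move/eqP; rewrite (negbTE (neq_lift _ _)).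
Qed.

(** The transposition joins the fixed point [ord0] to the cycle of [lift ord0 i], cancelling the
    cycle added by lifting. *)
Lemma ncycles_tperm_lift (n : nat) (s : 'S_n) (i : 'I_n) :
  ncycles (tperm ord0 (lift ord0 i) * lift_perm ord0 ord0 s)%g = ncycles s.
Proof.
have /eqP := porbits_mul_tperm (lift_perm ord0 ord0 s) ord0 (lift ord0 i).
rewrite porbit_lift_perm neq_lift -[#|porbits (lift_perm _ _ _)|]/(ncycles _).
rewrite ncycles_lift_perm; case: imsetP => [[x _ /eqP]|_ /=].
  by rewrite (negbTE (neq_lift _ _)).
by rewrite addn1 addn2 !eqSS => /eqP.
Qed.

(** * Expansion of the alpha-permanent along the first index *)

Section Recursion.
Variable C : numClosedFieldType.

(** A permutation uses one entry of row [i]; there the step from [i] to [j] becomes the two steps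
    from [i] through [ord0] to [j]. *)
Definition contract0 (n : nat) (A : 'M[C]_n.+1) (i : 'I_n) : 'M[C]_n :=
  \matrix_(k, j) (if k == i then A (lift ord0 i) ord0 * A ord0 (lift ord0 j)
                  else A (lift ord0 k) (lift ord0 j)).

Lemma perm_fix0_bij (n : nat) :
  {on [pred t : 'S_n.+1 | t ord0 == ord0], bijective (@lift_perm n ord0 ord0)}.
Proof.
(* The default [k] is never taken when [t] fixes [ord0], since no lifted index is then sent to
   [ord0]. *)
pose g (t : 'S_n.+1) (k : 'I_n) := odflt k (unlift ord0 (t (lift ord0 k))).
have gl (t : 'S_n.+1) k : t ord0 == ord0 -> lift ord0 (g t k) = t (lift ord0 k).
  move=> /eqP t0; rewrite /g; case: (unliftP ord0 (t (lift ord0 k))) => [j ->//|].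
  by rewrite -{2}t0 => /perm_inj/eqP; rewrite eq_sym (negbTE (neq_lift _ _)).
have g_inj (t : 'S_n.+1) : t ord0 == ord0 -> injective (g t).
  move=> t0 j k /(congr1 (lift ord0)); rewrite !gl // => /perm_inj.
  exact: lift_inj.
exists (fun t => odflt 1%g [pick s | lift_perm ord0 ord0 s == t]) => [s _|t].
  case: pickP => [u /eqP Eu|/(_ s)]; last by rewrite eqxx.
  apply/permP=> k; apply: (@lift_inj _ ord0).
  by rewrite -!(lift_perm_lift ord0 ord0) Eu.
rewrite inE => t0; case: pickP => [u /eqP //|/(_ (perm (g_inj t t0)))/eqP[]].
apply/permP=> k; case: (unliftP ord0 k) => [j|] ->.
  by rewrite lift_perm_lift permE gl.
by rewrite lift_perm_id (eqP t0).
Qed.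

(* A permutation moving 0 is a permutation of the other indices with 0 inserted
   into one of its cycles, just after an index [i]. *)
Lemma per_alpha_rec (n : nat) (alpha : C) (A : 'M[C]_n.+1) :
  per_alpha alpha A =
  alpha * A ord0 ord0 * per_alpha alpha (row' ord0 (col' ord0 A))
  + \sum_i per_alpha alpha (contract0 A i).
Proof.
rewrite /per_alpha (partition_big (fun s : 'S_n.+1 => (s^-1)%g ord0) predT) //=.
(* The permutations sending [y] to [ord0] form a coset of the stabiliser of [ord0]. *)
have reix (F : 'S_n.+1 -> C) y :
  \sum_(s : 'S_n.+1 | (s^-1)%g ord0 == y) F s =
  \sum_(s : 'S_n) F (tperm ord0 y * lift_perm ord0 ord0 s)%g.
  rewrite (reindex_inj (mulgI (tperm ord0 y))) /=.
  rewrite (reindex (@lift_perm n ord0 ord0)) /=.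
    apply: eq_bigl => s; rewrite invMg tpermV permM -[X in _ == X](tpermL ord0 y).
    by rewrite (inj_eq perm_inj) lift_permV lift_perm_id eqxx.
  apply: (subon_bij _ (@perm_fix0_bij n)) => t; rewrite !inE invMg tpermV permM.
  rewrite -[X in _ == X](tpermL ord0 y) (inj_eq perm_inj) -(inj_eq (@perm_inj _ t)).
  by rewrite permKV eq_sym => /eqP->.
rewrite big_ord_recl; congr (_ + _); last apply: eq_bigr => i _.
  rewrite reix mulr_sumr; apply: eq_bigr => s _.
  rewrite tperm1 mul1g ncycles_lift_perm big_ord_recl lift_perm_id exprS.
  rewrite -!mulrA; congr (_ * _); rewrite mulrCA; congr (_ * (_ * _)).
  by apply: eq_bigr => k _; rewrite lift_perm_lift !mxE.
rewrite reix; apply: eq_bigr => s _; rewrite ncycles_tperm_lift; congr (_ * _).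
rewrite big_ord_recl permM tpermL lift_perm_lift (bigD1 i) //= [RHS](bigD1 i) //=.
rewrite permM tpermR lift_perm_id mxE eqxx mulrCA mulrA; congr (_ * _).
apply: eq_bigr => k ki; rewrite mxE (negbTE ki) permM tpermD ?neq_lift //.
  by rewrite lift_perm_lift.
by rewrite (inj_eq lift_inj) eq_sym.
Qed.

(** With entries indexed by [nat] the expansion unfolds by computation for concrete [n], leaving
    identities for [ring]. *)
Fixpoint per_rec (alpha : C) (n : nat) (a : nat -> nat -> C) : C :=
  if n is m.+1 then
    alpha * a 0%N 0%N * per_rec alpha m (fun i j => a i.+1 j.+1)
    + \sum_(i <- iota 0 m) per_rec alpha m
        (fun k j => if k == i then a i.+1 0%N * a 0%N j.+1 else a k.+1 j.+1)
  else 1.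

Lemma per_alphaE (n : nat) (alpha : C) (a : nat -> nat -> C) :
  per_alpha alpha (\matrix_(i < n, j < n) a i j) = per_rec alpha n a.
Proof.
elim: n a => [|n IHn] a.
  rewrite /per_alpha (big_pred1 1%g) => [|s]; last by rewrite [s]permS0 /= eqxx.
  rewrite big_ord0 mulr1 /= /ncycles (_ : porbits _ = set0) ?cards0 //.
  by apply/setP=> X; rewrite inE; apply/imsetP=> -[[]].
rewrite per_alpha_rec /= mxE -!IHn; congr (_ * _ * per_alpha _ _ + _).
  by apply/matrixP=> i j; rewrite !mxE.
have -> : iota 0 n = index_iota 0 n by rewrite /index_iota subn0.
rewrite big_mkord; apply: eq_bigr => i _.
by rewrite -IHn; congr per_alpha; apply/matrixP=> k j; rewrite !mxE.
Qed.
End Recursion.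

(** * The case alpha = 1 *)

Section Gram.
Variable C : numClosedFieldType.

(** Schur's product theorem: expanding one factor by the Gram form multiplies the weights [y] by
    entries of [V]; with no factor left the sum is a squared modulus. *)
Lemma psd_power_ge0 (n : nat) (A V : 'M[C]_n) (I : finType) (K : Type)
    (r : seq K) (f : I -> K -> 'I_n) (P : pred I) (y : I -> C) :
  (forall i j, A i j = \sum_p (V p i)^* * V p j) ->
  0 <= \sum_(u | P u) \sum_(w | P w)
         (y u)^* * y w * \prod_(k <- r) A (f u k) (f w k).
Proof.
move=> AV; elim: r y => [|k r IHr] y.
  suff -> : \sum_(u | P u) \sum_(w | P w)
      (y u)^* * y w * \prod_(k <- [::]) A (f u k) (f w k)
      = (\sum_(u | P u) y u)^* * \sum_(w | P w) y w.
    by rewrite mulrC mul_conjC_ge0.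
  rewrite rmorph_sum mulr_suml; apply: eq_bigr => u _; rewrite mulr_sumr.
  by apply: eq_bigr => w _; rewrite big_nil mulr1.
pose z p u := y u * V p (f u k).
have -> : \sum_(u | P u) \sum_(w | P w)
      (y u)^* * y w * \prod_(k <- k :: r) A (f u k) (f w k)
   = \sum_p \sum_(u | P u) \sum_(w | P w)
      (z p u)^* * z p w * \prod_(k <- r) A (f u k) (f w k).
  rewrite [RHS]exchange_big; apply: eq_bigr => u _; rewrite [RHS]exchange_big.
  apply: eq_bigr => w _ /=; rewrite big_cons AV mulr_suml mulr_sumr.
  by apply: eq_bigr => p _; rewrite /z rmorphM; ring.
by apply: sumr_ge0 => p _; apply: IHr.
Qed.

(** By the spectral theorem, [V] consists of the rows of a unitary [P] scaled by the square roots of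
    the eigenvalues. *)
Lemma psd_gram (n : nat) (A : 'M[C]_n) : hermitian_mx A -> psd_mx A ->
  exists V : 'M[C]_n, forall i j, A i j = \sum_p (V p i)^* * V p j.
Proof.
move=> hA pA.
have hermA : A \is hermsymmx.
  by apply/is_hermitianmxP/matrixP => i j; rewrite !mxE expr0 mul1r [LHS]hA.
have := orthomx_spectralP (hermitian_normalmx hermA).
have Pu := spectral_unitarymx A; set P := spectralmx A in Pu *.
set d := spectral_diag A; rewrite (invmx_unitary Pu) => AE.
have entry i j : A i j = \sum_p (P p i)^* * d 0 p * P p j.
  rewrite {1}AE -mulmxA mxE; apply: eq_bigr => p _.
  by rewrite mul_diag_mx !mxE mulrA.
have dge0 p : 0 <= d 0 p.
  (* At the conjugate of row [p] of [P] the form takes the value [d 0 p]. *)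
  have := pA (\col_i (P p i)^*).
  suff -> : \sum_i \sum_j ((\col_i (P p i)^*) i 0)^* * A i j * (\col_i (P p i)^*) j 0
     = (P *m A *m map_mx (@Num.conj C) P^T) p p.
    rewrite {1}AE !mulmxA (unitarymxP Pu) mul1mx -mulmxA (unitarymxP Pu) mulmx1.
    by rewrite mxE eqxx.
  rewrite mxE exchange_big; apply: eq_bigr => j _; rewrite !mxE mulr_suml.
  by apply: eq_bigr => i _; rewrite !mxE conjCK.
exists (\matrix_(p, i) (sqrtC (d 0 p) * P p i)) => i j; rewrite entry.
apply: eq_bigr => p _; rewrite !mxE rmorphM /=.
have /conj_Creal -> : sqrtC (d 0 p) \is Num.real by rewrite ger0_real ?sqrtC_ge0.
by rewrite -{1}(sqrtCK (d 0 p)); ring.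
Qed.

Section Signed.
Variables (n : nat) (A : 'M[C]_n) (eps : C).
Hypotheses (hA : hermitian_mx A) (pA : psd_mx A).
Hypothesis eps2 : eps * eps = 1.
Hypothesis eps_conj : eps^* = eps.

Let sg (s : 'S_n) : C := eps ^+ s.

Let sgM s t : sg (s * t)%g = sg s * sg t.
Proof.
rewrite /sg odd_permM; case: (odd_perm s) (odd_perm t) => [] [] /=;
by rewrite ?expr0 ?expr1 ?mulr1 ?mul1r ?eps2.
Qed.

(* Writing a permutation as [tau^-1 * rho] in all possible ways and sorting by
   the slots [p = tau^-1 x] and [q = rho^-1 x], the swap of [p] and [q] in [tau]
   turns the sum into Hermitian squares. *)
Lemma moving_sum_ge0 (F : {set 'I_n}) (x : 'I_n) : x \notin F ->
  0 <= eps * \sum_(s : 'S_n | [forall i in F, s i == i] && (s x != x))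
         sg s * \prod_i A i (s i).
Proof.
move=> xF; set G := fun s : 'S_n => [forall i in F, s i == i].
have GP (s : 'S_n) : reflect (forall i, i \in F -> s i = i) (G s).
  by apply: (iffP forall_inP) => H i /H/eqP.
have GM s t : G s -> G t -> G (s * t)%g.
  by move=> /GP Gs /GP Gt; apply/GP=> i iF; rewrite permM Gs ?Gt.
have GV s : G s -> G (s^-1)%g.
  by move=> /GP Gs; apply/GP=> i iF; rewrite -{1}(Gs i iF) permK.
have GMl s t : G s -> G (s * t)%g = G t.
  by move=> Gs; apply/idP/idP => [/(GM _ _ (GV _ Gs))|/(GM _ _ Gs)//]; rewrite mulKg.
have [V AV] := psd_gram hA pA.
pose S := \sum_(s : 'S_n | G s && (s x != x)) sg s * \prod_i A i (s i).
pose H (t r : 'S_n) := sg t * sg r * \prod_k A (t k) (r k).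
pose W p q := \sum_(t | G t && (t p == x)) \sum_(r | G r && (r q == x)) H t r.
(* For each [t] in the stabiliser [G] put [s = t^-1 r]; then [t] and [r] determine [p] and [q], and
   [s] moves [x] exactly when [q != p]. *)
have cardS : #|[set t | G t]|%:R * S = \sum_p \sum_(q | q != p) W p q.
  have -> : #|[set t | G t]|%:R * S = \sum_(t | G t) S.
    by rewrite sumr_const mulr_natl; congr (_ *+ _); apply: eq_card => t; rewrite !inE.
  rewrite /W; under [RHS]eq_bigr => p _ do rewrite exchange_big /=.
  rewrite [RHS](exchange_big_dep G) /=; last by move=> p t _ /andP[].
  apply: eq_bigr => t Gt.
  rewrite [RHS](big_pred1 ((t^-1)%g x)); last first.
    by move=> p; rewrite Gt /= -(inj_eq (@perm_inj _ (t^-1)%g)) permK.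
  rewrite [RHS](exchange_big_dep (fun r => G r && (r ((t^-1)%g x) != x))) /=; last first.
    move=> q r qp /andP[-> /eqP rq] /=; apply: contraNneq qp => rp.
    by apply/eqP/(@perm_inj _ r); rewrite rq rp.
  rewrite /S (reindex_inj (mulgI (t^-1)%g)) /=.
  apply: eq_big => [r|r /andP[Gr rx]]; first by rewrite (GMl _ _ (GV _ Gt)) permM.
  rewrite [RHS](big_pred1 ((r^-1)%g x)); last first.
    rewrite (GMl _ _ (GV _ Gt)) in Gr; rewrite permM in rx.
    move=> q; rewrite Gr /= -[q == (r^-1)%g x](inj_eq (@perm_inj _ r)) permKV.
    case: (r q =P x) => [rq|_]; rewrite ?andbF // andbT.
    by apply: contraNneq rx => <-; rewrite rq.
  rewrite /H sgM; congr (_ * _ * _); first by rewrite /sg odd_permV.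
  rewrite (reindex_inj (@perm_inj _ t)); apply: eq_bigr => k _.
  by rewrite permM permK.
have Wge0 p q : q != p -> 0 <= eps * W p q.
  move=> qp; rewrite /W.
  have out (u : 'I_n) (t : 'S_n) : u \in F -> G t && (t u == x) = false.
    by move=> uF; apply/negP=> /andP[/GP/(_ u uF)-> /eqP ux]; rewrite -ux uF in xF.
  have [pF|pF] := boolP (p \in F).
    by rewrite big_pred0 ?mulr0 // => t; rewrite out.
  have [qF|qF] := boolP (q \in F).
    by rewrite big1 ?mulr0 // => t _; rewrite big_pred0 // => r; rewrite out.
  have Gpq : G (tperm p q).
    by apply/GP=> i iF; rewrite tpermD //; apply: contraTneq iF => <-.
  (* After the swap both [t] and [r] send [q] to [x]. The odd transposition supplies a second [eps],
     and the factors at [p] and [q] go into the weights [y]. *)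
  rewrite (reindex_inj (mulgI (tperm p q))) /=.
  pose y (r : 'S_n) := sg r * A x (r p).
  pose P (r : 'S_n) := G r && (r q == x).
  have := @psd_power_ge0 n A V 'S_n 'I_n
     [seq k <- index_enum 'I_n | (k != p) && (k != q)] (fun r k => r k) P y AV.
  suff -> : eps * (\sum_(t | G (tperm p q * t)%g && ((tperm p q * t)%g p == x))
     \sum_(r | G r && (r q == x)) H (tperm p q * t)%g r)
   = \sum_(u | P u) \sum_(w | P w) (y u)^* * y w *
      \prod_(k <- [seq k <- index_enum 'I_n | (k != p) && (k != q)]) A (u k) (w k) by [].
  rewrite mulr_sumr; apply: eq_big => [t|t]; first by rewrite (GMl _ _ Gpq) permM tpermL.
  rewrite (GMl _ _ Gpq) permM tpermL => /andP[Gt /eqP tq].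
  rewrite mulr_sumr; apply: eq_bigr => r /andP[Gr /eqP rq].
  rewrite big_filter /H sgM {1}/sg odd_tperm eq_sym qp expr1.
  rewrite (bigD1 p) //= (bigD1 q) //= !permM tpermL tpermR tq rq.
  rewrite /y rmorphM /= -(hA x (t p)) rmorphXn /= eps_conj -/(sg t).
  rewrite (eq_bigr (fun k => A (t k) (r k))) => [|k /andP[kp kq]]; last first.
    by rewrite permM tpermD // eq_sym.
  rewrite !mulrA eps2; ring.
have /pmulr_rge0 <- : 0 < #|[set t | G t]|%:R :> C.
  rewrite ltr0n; apply/card_gt0P; exists 1%g; rewrite inE.
  by apply/GP=> i _; rewrite perm1.
rewrite mulrCA cardS mulr_sumr; apply: sumr_ge0 => p _.
by rewrite mulr_sumr; apply: sumr_ge0 => q; apply: Wge0.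
Qed.

(** Induction on the number [k] of indices free to move: each step adds the permutations moving the
    new index [x], whose contribution is nonnegative by [moving_sum_ge0]. *)
Lemma signed_sum_ge0 :
  0 <= eps * (\sum_s sg s * \prod_i A i (s i) - \prod_i A i i).
Proof.
suff main k : (k <= n)%N ->
  0 <= eps * (\sum_(s : 'S_n | [forall i in [set i : 'I_n | (i < n - k)%N], s i == i])
                sg s * \prod_i A i (s i) - \prod_i A i i).
  have := main n (leqnn n); congr (0 <= eps * (_ - _)).
  by apply: eq_bigl => s; apply/forall_inP=> i; rewrite inE subnn.
elim: k => [|k IHk] kn.
  rewrite (big_pred1 1%g) => [|s].
    rewrite /sg odd_perm1 expr0 mul1r; under eq_bigr do rewrite perm1.
    by rewrite subrr mulr0.
  apply/forall_inP/eqP => [H|-> i _]; last by rewrite perm1.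
  by apply/permP=> i; rewrite perm1; apply/eqP/H; rewrite inE subn0.
have lt : (n - k.+1 < n)%N by rewrite ltn_subrL (leq_ltn_trans _ kn).
pose x := Ordinal lt.
rewrite (bigID (fun s : 'S_n => s x != x)) /= -addrA mulrDr addr_ge0 //.
  by apply: moving_sum_ge0; rewrite inE ltnn.
have := IHk (ltnW kn); congr (0 <= eps * (_ - _)).
apply: eq_bigl => s; rewrite negbK; apply/forall_inP/andP => [H|[/forall_inP H /eqP sx] i].
  split; last by apply: H; rewrite inE /= subnSK.
  apply/forall_inP=> i; rewrite inE => ik; apply: H.
  by rewrite inE (ltn_trans ik) //= subnSK.
rewrite inE -subnSK // ltnS leq_eqVlt => /orP[/eqP ix|ik]; last first.
  by apply: H; rewrite inE.
by have -> : i = x by [apply: val_inj]; rewrite sx.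
Qed.

(** The sign of [s] is the parity of [n] plus the number of cycles, and powers of [eps] depend only
    on parity. *)
Lemma per_signed : eps ^+ n * per_alpha eps A = \sum_s sg s * \prod_i A i (s i).
Proof.
rewrite mulr_sumr; apply: eq_bigr => s _; rewrite mulrA; congr (_ * _).
have expodd m : eps ^+ m = eps ^+ odd m.
  by rewrite -{1}(odd_double_half m) exprD -mul2n exprM expr2 eps2 expr1n mulr1.
by rewrite -exprD expodd oddD /sg /odd_perm card_ord.
Qed.

Lemma per_signed_ge0 :
  0 <= eps * (eps ^+ n * per_alpha eps A - \prod_i A i i).
Proof. by rewrite per_signed signed_sum_ge0. Qed.
End Signed.
End Gram.

(** * Sums over cycle types *)

Section CycleSums.
Variables (C : numClosedFieldType) (T : Type) (a : T -> T -> C).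

Definition cyc2 i j := a i j * a j i.
Definition cyc3 i j k := a i j * a j k * a k i + a i k * a k j * a j i.
Definition cyc4 i j k l :=
  a i j * a j k * a k l * a l i + a i l * a l k * a k j * a j i
  + (a i j * a j l * a l k * a k i + a i k * a k l * a l j * a j i)
  + (a i k * a k j * a j l * a l i + a i l * a l j * a j k * a k i).

(* [sum<type>_<n>] is the sum over the permutations of [n] points of the given
   cycle type, fixed points omitted. *)
Definition sum2_3 i j k := cyc2 i j + cyc2 i k + cyc2 j k.
Definition sum2_4 i j k l := cyc2 i j + sum2_3 i k l + sum2_3 j k l - cyc2 k l.
Definition sum3_4 i j k l := cyc3 i j k + cyc3 i j l + cyc3 i k l + cyc3 j k l.
Definition sum22_4 i j k l :=
  cyc2 i j * cyc2 k l + cyc2 i k * cyc2 j l + cyc2 i l * cyc2 j k.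

Definition sum_minors (F : T -> T -> T -> T -> C) v0 v1 v2 v3 v4 :=
  F v1 v2 v3 v4 + F v0 v2 v3 v4 + F v0 v1 v3 v4 + F v0 v1 v2 v4 + F v0 v1 v2 v3.

(* Each of the ten pairs, followed by the complementary triple. *)
Definition sum_edges (F : T -> T -> T -> T -> T -> C) v0 v1 v2 v3 v4 :=
  F v0 v1 v2 v3 v4 + F v0 v2 v1 v3 v4 + F v0 v3 v1 v2 v4 + F v0 v4 v1 v2 v3
  + F v1 v2 v0 v3 v4 + F v1 v3 v0 v2 v4 + F v1 v4 v0 v2 v3
  + F v2 v3 v0 v1 v4 + F v2 v4 v0 v1 v3 + F v3 v4 v0 v1 v2.

Definition sum2_5 := sum_edges (fun i j _ _ _ => cyc2 i j).
Definition sum3_5 := sum_edges (fun _ _ k l m => cyc3 k l m).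
Definition sum22_5 := sum_minors sum22_4.
Definition sum32_5 := sum_edges (fun i j k l m => cyc2 i j * cyc3 k l m).
Definition sum4_5 := sum_minors cyc4.

End CycleSums.

(** * Explicit polynomials in alpha for small n *)

Section Explicit.
Variable C : numClosedFieldType.
Implicit Types (x : C) (a : nat -> nat -> C).

Lemma per_recS x n a : per_rec x n.+1 a =
  x * a 0%N 0%N * per_rec x n (fun i j => a i.+1 j.+1)
  + \sum_(i <- iota 0 n) per_rec x n
      (fun k j => if k == i then a i.+1 0%N * a 0%N j.+1 else a k.+1 j.+1).
Proof. by []. Qed.

Lemma per_rec2 x a :
  per_rec x 2 a = x ^+ 2 * a 0%N 0%N * a 1%N 1%N + x * cyc2 a 0%N 1%N.
Proof. by rewrite /= !(big_cons, big_nil) /cyc2 /=; ring. Qed.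

Lemma per_rec3 x a :
  per_rec x 3 a = x ^+ 3 * a 0%N 0%N * a 1%N 1%N * a 2%N 2%N
  + x ^+ 2 * (cyc2 a 0%N 1%N * a 2%N 2%N + cyc2 a 0%N 2%N * a 1%N 1%N
              + cyc2 a 1%N 2%N * a 0%N 0%N)
  + x * cyc3 a 0%N 1%N 2%N.
Proof.
by rewrite per_recS !(big_cons, big_nil) !per_rec2 /cyc2 /cyc3 /=; ring.
Qed.

Lemma per_rec4 x a :
  per_rec x 4 a = x ^+ 4 * a 0%N 0%N * a 1%N 1%N * a 2%N 2%N * a 3%N 3%N
  + x ^+ 3 * (cyc2 a 0%N 1%N * a 2%N 2%N * a 3%N 3%N
              + cyc2 a 0%N 2%N * a 1%N 1%N * a 3%N 3%N
              + cyc2 a 0%N 3%N * a 1%N 1%N * a 2%N 2%N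
              + cyc2 a 1%N 2%N * a 0%N 0%N * a 3%N 3%N
              + cyc2 a 1%N 3%N * a 0%N 0%N * a 2%N 2%N
              + cyc2 a 2%N 3%N * a 0%N 0%N * a 1%N 1%N)
  + x ^+ 2 * (cyc3 a 0%N 1%N 2%N * a 3%N 3%N + cyc3 a 0%N 1%N 3%N * a 2%N 2%N
              + cyc3 a 0%N 2%N 3%N * a 1%N 1%N + cyc3 a 1%N 2%N 3%N * a 0%N 0%N
              + sum22_4 a 0%N 1%N 2%N 3%N)
  + x * cyc4 a 0%N 1%N 2%N 3%N.
Proof.
rewrite per_recS !(big_cons, big_nil) !per_rec3.
by rewrite /sum22_4 /cyc2 /cyc3 /cyc4 /=; ring.
Qed.

(* The 5-cycles are recovered from the value at [x = 1]. *)
Lemma per_rec5 x a : (forall i, a i i = 1) ->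
  let w := sum2_5 a 0%N 1%N 2%N 3%N 4%N in
  let u := sum3_5 a 0%N 1%N 2%N 3%N 4%N + sum22_5 a 0%N 1%N 2%N 3%N 4%N in
  let v := sum4_5 a 0%N 1%N 2%N 3%N 4%N + sum32_5 a 0%N 1%N 2%N 3%N 4%N in
  per_rec x 5 a = x ^+ 5 + x ^+ 4 * w + x ^+ 3 * u + x ^+ 2 * v
    + x * (per_rec 1 5 a - 1 - w - u - v).
Proof.
move=> a1 w u v; rewrite !(per_recS _ 4) !(big_cons, big_nil) !per_rec4.
rewrite /w /u /v /sum2_5 /sum3_5 /sum4_5 /sum32_5 /sum22_5 /sum_edges /sum_minors.
by rewrite /sum22_4 /cyc2 /cyc3 /cyc4 /= !a1; ring.
Qed.

End Explicit.

(** * Inequalities for positive semi-definite kernels *)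

Section Kernels.
Variable C : numClosedFieldType.

(** Lists of weighted points, repetitions allowed, replace vectors, so that one notion covers
    matrices, Schur complements and chosen families of indices. *)
Definition psd_kernel (T : Type) (a : T -> T -> C) : Prop :=
  forall s : seq (C * T),
    0 <= \sum_(p <- s) \sum_(q <- s) p.1^* * a p.2 q.2 * q.1.

Definition hermitian_kernel (T : Type) (a : T -> T -> C) : Prop :=
  forall i j, a j i = (a i j)^*.

Section General.
Variables (T : Type) (a : T -> T -> C).
Hypotheses (ah : hermitian_kernel a) (ap : psd_kernel a).

Lemma cyc2_ge0 i j : 0 <= cyc2 a i j.
Proof. by rewrite /cyc2 (ah i j) mul_conjC_ge0. Qed.

Lemma diag_ge0 i : 0 <= a i i.
Proof. by have := ap [:: (1, i)]; rewrite !big_seq1 conjC1 mul1r mulr1. Qed.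

Lemma diag_conj i : (a i i)^* = a i i.
Proof. by rewrite conj_Creal // ger0_real ?diag_ge0. Qed.

Lemma form2_ge0 x y i j :
  0 <= x^* * a i i * x + x^* * a i j * y + y^* * a j i * x + y^* * a j j * y.
Proof.
have := ap [:: (x, i); (y, j)]; rewrite !(big_cons, big_nil) /= !addr0.
by rewrite addrA.
Qed.

(** The form at [(- a k l, a k k)] is [a k k] times the minor. *)
Lemma minor2_ge0 i j : 0 <= a i i * a j j - cyc2 a i j.
Proof.
have pos k l : 0 < a k k -> 0 <= a k k * a l l - cyc2 a k l.
  move=> k0; rewrite -(pmulr_rge0 _ k0); have := form2_ge0 (- a k l) (a k k) k l.
  by rewrite rmorphN /= -ah diag_conj /cyc2; congr (0 <= _); ring.
have := diag_ge0 i; rewrite le_eqVlt => /orP[/eqP i0|/pos//].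
have := diag_ge0 j; rewrite le_eqVlt => /orP[/eqP j0|/(pos j i)]; last first.
  by rewrite /cyc2 mulrC [a j i * _]mulrC.
(* Both diagonal entries vanish here, so this vector gives minus twice the squared modulus of
   [a i j]. *)
have := form2_ge0 (- a i j) 1 i j; rewrite -i0 -j0 rmorphN /= -ah conjC1 /cyc2.
rewrite (_ : _ + _ = - (a i j * a j i) *+ 2); last by ring.
by rewrite pmulrn_lge0 // mul0r add0r.
Qed.

(** The form on [j], [k] is evaluated at [(a i k, - a i j)], a vector annihilated by row [i]. *)
Lemma minor3_le i j k :
  0 <= a j j * cyc2 a i k + a k k * cyc2 a i j - cyc3 a i j k.
Proof.
have := form2_ge0 (a i k) (- a i j) j k; rewrite rmorphN /= -!ah /cyc2 /cyc3.
by congr (0 <= _); ring.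
Qed.

Definition schur_kernel z i j := a i j - a i z * a z j.

Lemma schur_hermitian z : hermitian_kernel (schur_kernel z).
Proof. by move=> i j; rewrite /schur_kernel rmorphB rmorphM /= -!ah mulrC. Qed.

(** Adding the point [z] with the weight that minimises the form leaves the form of the Schur
    complement. *)
Lemma schur_psd z : a z z = 1 -> psd_kernel (schur_kernel z).
Proof.
move=> z1 s; have := ap ((- \sum_(p <- s) a z p.2 * p.1, z) :: s).
rewrite !big_cons /= z1 mulr1; set u := \sum_(p <- s) a z p.2 * p.1.
under [X in _ <= _ + X]eq_bigr do rewrite big_cons /=.
rewrite big_split /= -mulr_suml.
have -> : \sum_(p <- s) p.1^* * a p.2 z = u^*.
  by rewrite rmorph_sum; apply: eq_bigr => p _ /=; rewrite rmorphM /= -ah mulrC.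
under eq_bigr do rewrite -mulrA; rewrite -mulr_sumr -/u rmorphN /=.
have -> : \sum_(p <- s) \sum_(q <- s) p.1^* * schur_kernel z p.2 q.2 * q.1
  = \sum_(p <- s) \sum_(q <- s) p.1^* * a p.2 q.2 * q.1 - u^* * u.
  rewrite /u rmorph_sum /= mulr_suml -sumrB; apply: eq_bigr => p _.
  rewrite mulr_sumr -sumrB; apply: eq_bigr => q _.
  by rewrite rmorphM /= -ah /schur_kernel; ring.
by congr (0 <= _); ring.
Qed.

Lemma kernel_matrix_psd n (v : nat -> T) :
  psd_mx (\matrix_(i < n, j < n) a (v i) (v j)).
Proof.
move=> x; have := ap [seq (x i 0, v i) | i : 'I_n <- enum 'I_n].
rewrite big_map big_enum /=; congr (0 <= _); apply: eq_bigr => i _.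
by rewrite big_map big_enum /=; apply: eq_bigr => j _; rewrite !mxE.
Qed.

Lemma kernel_matrix_hermitian n (v : nat -> T) :
  hermitian_mx (\matrix_(i < n, j < n) a (v i) (v j)).
Proof. by move=> i j; rewrite !mxE. Qed.

End General.

(** * Kernels with unit diagonal: triangles and 4 x 4 minors *)

Section UnitDiagonal.
Variables (T : Type) (a : T -> T -> C).
Hypotheses (ah : hermitian_kernel a) (ap : psd_kernel a).
Hypothesis a1 : forall i, a i i = 1.

Lemma cyc2_le1 i j : 0 <= 1 - cyc2 a i j.
Proof. by have := minor2_ge0 ah ap i j; rewrite !a1 mulr1. Qed.

(** This 3 x 3 determinant is the 2 x 2 minor of the Schur complement at [i]. *)
Lemma det3_ge0 i j k : 0 <= 1 - sum2_3 a i j k + cyc3 a i j k.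
Proof.
have := minor2_ge0 (schur_hermitian ah i) (schur_psd ah ap (a1 i)) j k.
rewrite /sum2_3 /cyc2 /cyc3 /schur_kernel !a1; congr (0 <= _); ring.
Qed.

Lemma cyc3_square (eps : C) i j k : eps * eps = 1 -> eps^* = eps ->
  0 <= cyc2 a i j * cyc2 a j k + cyc2 a i k + eps * cyc3 a i j k.
Proof.
move=> e2 ec; have := mul_conjC_ge0 (eps * (a i j * a j k) + a i k).
rewrite rmorphD !rmorphM /= ec -!ah /cyc2 /cyc3; congr (0 <= _).
rewrite mulrDr !mulrDl [X in X + _ + _]mulrACA e2; ring.
Qed.

(** The squares are summed over the rotations of the triangle; a product of two edges is at most
    either one, as each [cyc2] is at most 1. *)
Lemma cyc3_bound (eps : C) i j k : eps * eps = 1 -> eps^* = eps ->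
  0 <= 2 * sum2_3 a i j k + 3 * (eps * cyc3 a i j k).
Proof.
move=> e2 ec;
have sq p q r := cyc3_square p q r e2 ec.
have pr p q r s : 0 <= cyc2 a p q * (1 - cyc2 a r s).
  by rewrite mulr_ge0 ?cyc2_ge0 ?cyc2_le1.
rewrite (_ : _ + _ =
    (cyc2 a i j * cyc2 a j k + cyc2 a i k + eps * cyc3 a i j k)
  + (cyc2 a j k * cyc2 a k i + cyc2 a j i + eps * cyc3 a j k i)
  + (cyc2 a k i * cyc2 a i j + cyc2 a k j + eps * cyc3 a k i j)
  + (cyc2 a i j * (1 - cyc2 a j k) + cyc2 a j k * (1 - cyc2 a i k)
     + cyc2 a i k * (1 - cyc2 a i j))).
  by do ![exact: sq | exact: pr | apply: addr_ge0].
by rewrite /sum2_3 /cyc2 /cyc3; ring.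
Qed.

Lemma sum2_3_ge0 i j k : 0 <= sum2_3 a i j k.
Proof. by rewrite !addr_ge0 ?cyc2_ge0. Qed.

Lemma cyc3_half i j k : 0 <= sum2_3 a i j k + 2 * cyc3 a i j k.
Proof.
have T0 := sum2_3_ge0 i j k.
have T9 : 0 < 9 + sum2_3 a i j k by rewrite ltr_pwDl ?ltr0n.
rewrite -(pmulr_rge0 _ T9).
have sq p q r := cyc3_square p q r (mulr1 1) (conjC1 C).
(* With [T = sum2_3] and [P] the sum of products of two distinct edges, the squares give
   [6P + 6T + 18 C3] and the determinant term [2T - 2T^2 + 2T C3]. The edge squares complete [6P] to
   [3T^2], and all adds up to [(9 + T) (T + 2 C3)]. *)
rewrite (_ : (9 + _) * _ =
  2 * ((cyc2 a i j * cyc2 a j k + cyc2 a i k + 1 * cyc3 a i j k)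
     + (cyc2 a j k * cyc2 a k i + cyc2 a j i + 1 * cyc3 a j k i)
     + (cyc2 a k i * cyc2 a i j + cyc2 a k j + 1 * cyc3 a k i j)) *+ 3
  + 2 * sum2_3 a i j k * (1 - sum2_3 a i j k + cyc3 a i j k)
  + (sum2_3 a i j k + (cyc2 a i j * cyc2 a i j + cyc2 a i k * cyc2 a i k
     + cyc2 a j k * cyc2 a j k) *+ 3)).
  have c0 p q := cyc2_ge0 ah p q.
  by do ![exact: sq | exact: det3_ge0 | exact: sum2_3_ge0 | exact: c0
         | exact: ler0n | apply: addr_ge0 | apply: mulrn_wge0 | apply: mulr_ge0].
by rewrite /sum2_3 /cyc2 /cyc3; ring.
Qed.

(** For unit diagonal this is [eps (eps^4 per_eps A - 1)] on the 4 x 4 minor. *)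
Definition signed_sum4 (eps : C) i j k l :=
  sum2_4 a i j k l + eps * (sum3_4 a i j k l + sum22_4 a i j k l) + cyc4 a i j k l.

(* Fischer's inequality for the splitting {i,j},{k,l}, proved through the Schur
   complement of the entry (i,i). *)
Lemma fischer4 i j k l :
  0 <= signed_sum4 (-1) i j k l - (cyc2 a i j + cyc2 a k l - cyc2 a i j * cyc2 a k l).
Proof.
have hb := schur_hermitian ah i; have pb := schur_psd ah ap (a1 i).
have := minor3_le hb pb j k l; have := minor3_le ah ap i k l.
(* Expanding the 4 x 4 determinant as that of the Schur complement on [j], [k], [l], whose [(j,j)]
   entry is [1 - cyc2 a i j], makes Fischer's difference the sum of these two bounds. *)
move=> /(mulr_ge0 (cyc2_le1 i j)) h1 h2; have := addr_ge0 h2 h1.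
rewrite /signed_sum4 /sum2_4 /sum2_3 /sum3_4 /sum22_4 /cyc2 /cyc3 /cyc4 /schur_kernel !a1.
by congr (0 <= _); ring.
Qed.

Lemma per_rec_signed_ge0 n (v : nat -> T) (eps : C) :
  eps * eps = 1 -> eps^* = eps ->
  0 <= eps * (eps ^+ n * per_rec eps n (fun i j => a (v i) (v j)) - 1).
Proof.
move=> e2 ec.
have := per_signed_ge0 (kernel_matrix_hermitian ah v) (kernel_matrix_psd ap v) e2 ec.
move=> /(_ n); rewrite (per_alphaE n eps (fun i j => a (v i) (v j))) big1 // => i _.
by rewrite mxE.
Qed.

Lemma per_rec4_unit x v0 v1 v2 v3 :
  let v := nth v0 [:: v0; v1; v2; v3] in per_rec x 4 (fun i j => a (v i) (v j)) =
  x ^+ 4 + x ^+ 3 * sum2_4 a v0 v1 v2 v3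
  + x ^+ 2 * (sum3_4 a v0 v1 v2 v3 + sum22_4 a v0 v1 v2 v3)
  + x * cyc4 a v0 v1 v2 v3.
Proof.
move=> v; rewrite per_rec4 /sum2_4 /sum2_3 /sum3_4 /sum22_4 /cyc2 /cyc3 /cyc4 /= !a1.
by ring.
Qed.

Lemma signed_sum4_ge0 eps i j k l : eps = 1 \/ eps = -1 -> 0 <= signed_sum4 eps i j k l.
Proof.
move=> eE; have e2 : eps * eps = 1 by case: eE => ->; ring.
have ec : eps^* = eps by case: eE => ->; rewrite ?rmorphN /= conjC1.
have := @per_rec_signed_ge0 4 (nth i [:: i; j; k; l]) eps e2 ec.
rewrite per_rec4_unit /signed_sum4; congr (0 <= _).
by case: eE => ->; ring.
Qed.
End UnitDiagonal.
End Kernels.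

(** * Unit diagonal, arbitrary alpha *)

Section Bounds.
Variables (C : numClosedFieldType) (T : Type) (a : T -> T -> C).
Hypotheses (ah : hermitian_kernel a) (ap : psd_kernel a).
Hypothesis a1 : forall i, a i i = 1.
Variables (eps t : C).
Hypothesis epsE : eps = 1 \/ eps = -1.
Hypothesis t0 : 0 <= t.

Let eps2 : eps * eps = 1. Proof. by case: epsE => ->; ring. Qed.
Let eps_conj : eps^* = eps.
Proof. by case: epsE => ->; rewrite ?rmorphN /= conjC1. Qed.

Let e0 i j : 0 <= cyc2 a i j. Proof. exact: cyc2_ge0. Qed.
Let e1 i j : 0 <= 1 - cyc2 a i j. Proof. exact: cyc2_le1. Qed.

Lemma sum_minors_ge0 (F : T -> T -> T -> T -> C) v0 v1 v2 v3 v4 :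
  (forall i j k l, 0 <= F i j k l) -> 0 <= sum_minors F v0 v1 v2 v3 v4.
Proof. by move=> F0; rewrite !addr_ge0. Qed.

Lemma sum_edges_ge0 (F : T -> T -> T -> T -> T -> C) v0 v1 v2 v3 v4 :
  (forall i j k l m, 0 <= F i j k l m) -> 0 <= sum_edges F v0 v1 v2 v3 v4.
Proof. by move=> F0; rewrite !addr_ge0. Qed.

(** This is [sum2_4 - 2 sum22_4]: a perfect matching with edges [e], [f] contributes
    [e + f - 2 e f]. *)
Definition matching_slack i j k l :=
  cyc2 a i j * (1 - cyc2 a k l) + cyc2 a k l * (1 - cyc2 a i j)
  + (cyc2 a i k * (1 - cyc2 a j l) + cyc2 a j l * (1 - cyc2 a i k))
  + (cyc2 a i l * (1 - cyc2 a j k) + cyc2 a j k * (1 - cyc2 a i l)).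

Lemma matching_slack_ge0 i j k l : 0 <= matching_slack i j k l.
Proof. by rewrite /matching_slack !addr_ge0 // mulr_ge0. Qed.

Lemma sum22_4_ge0 i j k l : 0 <= sum22_4 a i j k l.
Proof. by rewrite /sum22_4 !addr_ge0 // mulr_ge0. Qed.

Lemma sum2_4_ge0 i j k l : 0 <= sum2_4 a i j k l.
Proof.
rewrite (_ : _ i j k l = sum2_3 a i j k + cyc2 a i l + cyc2 a j l + cyc2 a k l).
  by rewrite !addr_ge0 ?sum2_3_ge0.
by rewrite /sum2_4 /sum2_3; ring.
Qed.

Definition triangle_slack (e : C) i j k :=
  2 * sum2_3 a i j k + 3 * (e * cyc3 a i j k).

(** For n = 4 the quantity is alpha times its value at alpha = 1 plus [t] times this slope. The
    triangles absorb the 3-cycles; the transpositions left over dominate the double ones. *)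
Lemma slope4_ge0 i j k l :
  0 <= (2 + t) * sum2_4 a i j k l + eps * (sum3_4 a i j k l + sum22_4 a i j k l).
Proof.
have c3 p q r : 0 <= triangle_slack eps p q r.
  exact: cyc3_bound.
rewrite -(@pmulr_rge0 _ 6) ?ltr0n //.
set W := triangle_slack eps i j k + triangle_slack eps i j l
         + triangle_slack eps i k l + triangle_slack eps j k l.
have W0 : 0 <= W by do ![exact: c3 | apply: addr_ge0].
have [S0 Q0] := (sum2_4_ge0 i j k l, sum22_4_ge0 i j k l).
have M0 := matching_slack_ge0 i j k l.
have -> : 6 * ((2 + t) * sum2_4 a i j k l
             + eps * (sum3_4 a i j k l + sum22_4 a i j k l))
  = 6 * (t * sum2_4 a i j k l) + 2 * W
    + (4 * sum2_4 a i j k l + 6 * (eps * sum22_4 a i j k l)).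
  by rewrite /W /triangle_slack /sum2_4 /sum2_3 /sum3_4; ring.
rewrite addr_ge0 //; first by rewrite addr_ge0 ?mulr_ge0 ?ler0n.
case: epsE => ->; first by rewrite addr_ge0 ?mulr_ge0 ?ler0n ?ler01.
rewrite (_ : _ + _ = sum2_4 a i j k l + 3 * matching_slack i j k l).
  by rewrite addr_ge0 ?mulr_ge0 ?ler0n.
by rewrite /matching_slack /sum2_4 /sum2_3 /sum22_4; ring.
Qed.

(** Fischer's inequality summed over the three splittings of four points into pairs. *)
Definition fischer_slack i j k l :=
  3 * signed_sum4 a (-1) i j k l - sum2_4 a i j k l + sum22_4 a i j k l.

Lemma fischer_slack_ge0 i j k l : 0 <= fischer_slack i j k l.
Proof.
have := addr_ge0 (addr_ge0 (fischer4 ah ap a1 i j k l) (fischer4 ah ap a1 i k j l))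
          (fischer4 ah ap a1 i l j k).
rewrite /fischer_slack /signed_sum4 /sum2_4 /sum3_4 /sum22_4 /sum2_3 /cyc2 /cyc3 /cyc4.
by congr (0 <= _); ring.
Qed.

(** * The slope in t for five points *)

Section Five.
Variables v0 v1 v2 v3 v4 : T.
Let minors (F : T -> T -> T -> T -> C) := sum_minors F v0 v1 v2 v3 v4.
Let edges (F : T -> T -> T -> T -> T -> C) := sum_edges F v0 v1 v2 v3 v4.
Let w := sum2_5 a v0 v1 v2 v3 v4.
Let q := sum22_5 a v0 v1 v2 v3 v4.
Let u := sum3_5 a v0 v1 v2 v3 v4 + q.
Let v := sum4_5 a v0 v1 v2 v3 v4 + sum32_5 a v0 v1 v2 v3 v4.

Let w0 : 0 <= w. Proof. exact: sum_edges_ge0. Qed.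
Let q0 : 0 <= q. Proof. by apply: sum_minors_ge0 => *; apply: sum22_4_ge0. Qed.

Ltac unfold_sums :=
  rewrite /w /u /v /q /minors /edges /sum2_5 /sum3_5 /sum22_5 /sum4_5 /sum32_5
    /sum_edges /sum_minors /fischer_slack /signed_sum4 /triangle_slack /matching_slack
    /sum2_4 /sum3_4 /sum22_4 /sum2_3.

Lemma slope5_plus_ge0 : 0 <= (t ^+ 2 + 3 * t + 3) * w + (t + 2) * u + v.
Proof.
rewrite -(@pmulr_rge0 _ 6) ?ltr0n //.
(* A pair lies in three 4-subsets and a triple in two, so at [t = 0] the minors leave [q] plus the
   (3,2) sum, half of the first edge sum. *)
have -> : 6 * ((t ^+ 2 + 3 * t + 3) * w + (t + 2) * u + v) =
    6 * minors (signed_sum4 a 1)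
  + 3 * edges (fun i j k l m => cyc2 a i j * (sum2_3 a k l m + 2 * cyc3 a k l m))
  + 2 * t * (3 * w + 3 * q + edges (fun _ _ k l m => triangle_slack 1 k l m))
  + 6 * (t ^+ 2 * w).
  by unfold_sums; ring.
have h1 : 0 <= minors (signed_sum4 a 1).
  by apply: sum_minors_ge0 => *; apply: signed_sum4_ge0 => //; left.
have h2 : 0 <= edges (fun i j k l m =>
    cyc2 a i j * (sum2_3 a k l m + 2 * cyc3 a k l m)).
  by apply: sum_edges_ge0 => *; rewrite mulr_ge0 ?cyc3_half.
have h3 : 0 <= edges (fun _ _ k l m => triangle_slack 1 k l m).
  by apply: sum_edges_ge0 => *; apply: cyc3_bound; rewrite ?mulr1 ?conjC1.
move: w0 q0 h1 h2 h3; move: w q (minors _) (edges _) (edges _) => W Q M E1 E2 *.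
by rewrite !addr_ge0 ?mulr_ge0 ?addr_ge0 ?mulr_ge0 ?exprn_ge0 ?ler0n.
Qed.

Lemma slope5_minus_ge0 : 0 <= (t ^+ 2 + 3 * t + 3) * w - (t + 2) * u + v.
Proof.
rewrite -(@pmulr_rge0 _ 24) ?ltr0n //.
(* Once the other terms are matched, [q] keeps the coefficient [16 t^2 - 24 t + 16], made positive
   by completing the square. *)
have -> : 24 * ((t ^+ 2 + 3 * t + 3) * w - (t + 2) * u + v) =
    q * ((4 * t - 3) ^+ 2 + 7) + 24 * (t * w)
  + 8 * minors fischer_slack
  + 24 * edges (fun i j k l m => cyc2 a i j * (1 - sum2_3 a k l m + cyc3 a k l m))
  + 8 * t * edges (fun _ _ k l m => triangle_slack (-1) k l m)
  + 8 * (t ^+ 2 * minors matching_slack).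
  by unfold_sums; ring.
have h1 : 0 <= minors fischer_slack.
  by apply: sum_minors_ge0 => *; apply: fischer_slack_ge0.
have h2 : 0 <= edges (fun i j k l m =>
    cyc2 a i j * (1 - sum2_3 a k l m + cyc3 a k l m)).
  by apply: sum_edges_ge0 => *; rewrite mulr_ge0 ?det3_ge0.
have h3 : 0 <= edges (fun _ _ k l m => triangle_slack (-1) k l m).
  apply: sum_edges_ge0 => *.
  by apply: cyc3_bound; rewrite ?mulrNN ?mulr1 ?rmorphN /= ?conjC1.
have h4 : 0 <= minors matching_slack.
  by apply: sum_minors_ge0 => *; apply: matching_slack_ge0.
have h5 : 0 <= (4 * t - 3) ^+ 2.
  rewrite real_exprn_even_ge0 // rpredB ?rpredM ?realn //.
  exact: ger0_real.
move: w0 q0 h1 h2 h3 h4 h5.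
move: w q (minors fischer_slack) (edges _) (edges _) (minors matching_slack) ((4 * t - 3) ^+ 2).
move=> W Q M E1 E2 M' X *.
by rewrite !addr_ge0 ?mulr_ge0 ?addr_ge0 ?mulr_ge0 ?exprn_ge0 ?ler0n.
Qed.
End Five.

Variable f : nat -> T.
Let b i j := a (f i) (f j).
Let al := 1 + t.

Lemma per_rec_unit_bound n : (n <= 5)%N ->
  0 <= eps * (eps ^+ n * per_rec (eps * al) n b - al ^+ n).
Proof.
have al0 : 0 <= al by rewrite addr_ge0 ?ler01.
have b1 i : b i i = 1 by rewrite /b.
have sg n := per_rec_signed_ge0 ah ap a1 n f eps2 eps_conj.
case: n => [|[|[|[|[|[|//]]]]]] _.
- by rewrite /= !expr0 mulr1 subrr mulr0.
- rewrite /= big_nil b1 (_ : _ * _ = 0) //.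
  by case: epsE => ->; ring.
- rewrite per_rec2 !b1 (_ : _ * _ = al * cyc2 b 0%N 1%N).
    by rewrite mulr_ge0 //; apply: e0.
  by case: epsE => ->; ring.
(* The factor 3 brings out the [2 T + 3 eps C3] of [triangle_slack], with [(3t + 1) T] to spare. *)
- rewrite per_rec3 !b1 -(@pmulr_rge0 _ 3) ?ltr0n //.
  have -> : 3 * (eps * (eps ^+ 3 * ((eps * al) ^+ 3 * 1 * 1 * 1
      + (eps * al) ^+ 2
        * (cyc2 b 0%N 1%N * 1 + cyc2 b 0%N 2%N * 1 + cyc2 b 1%N 2%N * 1)
      + eps * al * cyc3 b 0%N 1%N 2%N) - al ^+ 3)) =
    al * ((3 * t + 1) * sum2_3 a (f 0%N) (f 1%N) (f 2%N)
          + triangle_slack eps (f 0%N) (f 1%N) (f 2%N)).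
    rewrite /triangle_slack /sum2_3 /al -!/(cyc2 b _ _) -/(cyc3 b 0%N 1%N 2%N).
    by case: epsE => ->; ring.
  rewrite mulr_ge0 // addr_ge0 ?cyc3_bound // mulr_ge0 ?sum2_3_ge0 //.
  by rewrite addr_ge0 ?ler01 ?mulr_ge0 ?ler0n.
- have := sg 4%N; rewrite -/b !per_rec4 !b1 => h.
  have s4 := slope4_ge0 (f 0%N) (f 1%N) (f 2%N) (f 3%N).
  have := mulr_ge0 al0 (addr_ge0 h (mulr_ge0 t0 s4)).
  congr (0 <= _); rewrite /sum2_4 /sum3_4 /sum22_4 /sum2_3 /cyc2 /cyc3 /cyc4 /b /al.
  by case: epsE => ->; ring.
have := sg 5%N; rewrite -/b.
have := fun x => per_rec5 x b1.
set S2 := sum2_5 _ _ _ _ _ _; set S3 := sum3_5 _ _ _ _ _ _.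
set S22 := sum22_5 _ _ _ _ _ _.
set S4 := sum4_5 _ _ _ _ _ _; set S32 := sum32_5 _ _ _ _ _ _ => /= E h.
rewrite E; rewrite E in h.
have := slope5_plus_ge0 (f 0%N) (f 1%N) (f 2%N) (f 3%N) (f 4%N).
have := slope5_minus_ge0 (f 0%N) (f 1%N) (f 2%N) (f 3%N) (f 4%N).
rewrite -[sum2_5 a _ _ _ _ _]/S2 -[sum3_5 a _ _ _ _ _]/S3 -[sum4_5 a _ _ _ _ _]/S4.
rewrite -[sum22_5 a _ _ _ _ _]/S22 -[sum32_5 a _ _ _ _ _]/S32 => m p.
case: epsE h => -> h.
  have := mulr_ge0 al0 (addr_ge0 h (mulr_ge0 t0 p)).
  by congr (0 <= _); rewrite /al; ring.
have := mulr_ge0 al0 (addr_ge0 h (mulr_ge0 t0 m)).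
by congr (0 <= _); rewrite /al; ring.
Qed.
End Bounds.

(** * Normalising the diagonal *)

Section Normalisation.
Variable C : numClosedFieldType.

(** A weighted list acts as the vector collecting the total weight at each index. *)
Lemma psd_mx_kernel n (A : 'M[C]_n) : psd_mx A -> psd_kernel A.
Proof.
move=> pA s; have := pA (\col_i \sum_(p <- s | p.2 == i) p.1); congr (0 <= _).
under eq_bigr do under eq_bigr do rewrite !mxE rmorph_sum !mulr_suml /=.
under eq_bigr do rewrite exchange_big /=.
rewrite (exchange_big_dep predT) //=; apply: eq_bigr => p _.
rewrite (big_pred1 p.2) => [|i]; last by rewrite eq_sym.
under eq_bigr do rewrite mulr_sumr.
rewrite (exchange_big_dep predT) //=; apply: eq_bigr => q _.
by rewrite (big_pred1 q.2) // => j; rewrite eq_sym.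
Qed.

Lemma per_alpha_unit_bound n (A : 'M[C]_n) (eps t : C) :
  (n <= 5)%N -> hermitian_mx A -> psd_mx A -> (forall i, A i i = 1) ->
  eps = 1 \/ eps = -1 -> 0 <= t ->
  0 <= eps * (eps ^+ n * per_alpha (eps * (1 + t)) A - (1 + t) ^+ n).
Proof.
(* The empty matrix is separate because [inord] needs an inhabited index type. *)
case: n A => [|n] A n5 hA pA A1 eE t0.
  have -> : A = \matrix_(i < 0, j < 0) 0 by apply/matrixP=> -[].
  by rewrite (per_alphaE 0 _ (fun _ _ => 0)) !expr0 mulr1 subrr mulr0.
have -> : A = \matrix_(i < n.+1, j < n.+1) A (inord i) (inord j).
  by apply/matrixP=> i j; rewrite mxE !inord_val.
rewrite (per_alphaE _ _ (fun i j => A (inord i) (inord j))).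
exact: (per_rec_unit_bound hA (psd_mx_kernel pA) A1 eE t0 (fun i => inord i)).
Qed.

Lemma per_alpha_scale n (A B : 'M[C]_n) (d : 'I_n -> C) (al : C) :
  (forall i j, A i j = d i * B i j * d j) ->
  per_alpha al A = (\prod_i d i) ^+ 2 * per_alpha al B.
Proof.
move=> AB; rewrite mulr_sumr; apply: eq_bigr => s _; rewrite mulrCA; congr (_ * _).
rewrite (eq_bigr (fun i => d i * B i (s i) * d (s i))) => [|i _]; last exact: AB.
have ds : \prod_i d (s i) = \prod_i d i by rewrite [RHS](reindex_inj (@perm_inj _ s)).
rewrite !big_split /= ds.
by ring.
Qed.

Lemma per_alpha_bound n (A : 'M[C]_n) (eps al : C) :
  (n <= 5)%N -> hermitian_mx A -> psd_mx A ->
  eps = 1 \/ eps = -1 -> 1 <= al ->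
  0 <= eps * (eps ^+ n * per_alpha (eps * al) A - al ^+ n * \prod_i A i i).
Proof.
move=> n5 hA pA eE al1; have kA := psd_mx_kernel pA.
have D0 i : 0 <= A i i := diag_ge0 kA i.
(* A zero on the diagonal annihilates its row, by the 2 x 2 minors, and both terms vanish. *)
case: (pickP (fun i => A i i == 0)) => [k /eqP k0|Dn0].
  have row0 j : A k j = 0.
    apply/eqP; rewrite -normr_eq0 -sqrf_eq0 normCK -hA eq_le.
    have := minor2_ge0 hA kA k j; rewrite k0 mul0r sub0r oppr_ge0 => ->.
    exact: (cyc2_ge0 hA).
  rewrite /per_alpha (bigD1 k) //= k0 mul0r mulr0 subr0 big1 ?mulr0 // => s _.
  by rewrite (bigD1 k) //= row0 mul0r mulr0.
pose d i := sqrtC (A i i).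
have d2 i : d i ^+ 2 = A i i by rewrite sqrtCK.
have dn0 i : d i != 0 by rewrite sqrtC_eq0 Dn0.
have dc i : (d i)^* = d i by rewrite conj_Creal // ger0_real ?sqrtC_ge0.
(* This congruence makes the diagonal 1 and divides both terms of the bound by the product of the
   diagonal entries. *)
pose B : 'M[C]_n := \matrix_(i, j) ((d i)^-1 * A i j * (d j)^-1).
have AB i j : A i j = d i * B i j * d j.
  by rewrite mxE mulrA mulrA mulfV // mul1r mulfVK.
have hB : hermitian_mx B.
  by move=> i j; rewrite !mxE !rmorphM /= !fmorphV /= !dc -hA; ring.
have B1 i : B i i = 1.
  by rewrite mxE -d2 expr2 mulrA mulVf // mul1r mulfV.
have pB : psd_mx B.
  move=> x; have := pA (\col_i ((d i)^-1 * x i 0)); congr (0 <= _).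
  apply: eq_bigr => i _; apply: eq_bigr => j _.
  by rewrite !mxE rmorphM /= fmorphV /= dc; ring.
have t0 : 0 <= al - 1 by rewrite subr_ge0.
have := per_alpha_unit_bound n5 hB pB B1 eE t0; rewrite (addrC 1) subrK => h.
rewrite (per_alpha_scale _ AB).
have -> : \prod_i A i i = (\prod_i d i) ^+ 2.
  by rewrite -prodrXl; apply: eq_bigr => i _; rewrite d2.
have D2 : 0 <= (\prod_i d i) ^+ 2.
  by rewrite exprn_ge0 // prodr_ge0 // => i _; rewrite sqrtC_ge0.
have := mulr_ge0 D2 h; congr (0 <= _); ring.
Qed.
End Normalisation.

Theorem mainTheorem8 (C : numClosedFieldType) (n : nat) (alpha : C)
  (Hn : (n <= 5)%N) (Hreal : alpha \is Num.real) (Halpha : 1 <= alpha)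
  (A : 'M[C]_n) (HA : hermitian_mx A) (HP : psd_mx A) :
  alpha ^+ n * \prod_(i < n) A i i <= per_alpha alpha A /\
  (-1) ^+ n * per_alpha (- alpha) A <= alpha ^+ n * \prod_(i < n) A i i.
Proof.
have bound eps eE := @per_alpha_bound C n A eps alpha Hn HA HP eE Halpha.
split; rewrite -subr_ge0.
  by have := bound 1 (or_introl erefl); rewrite expr1n !mul1r.
by have := bound (-1) (or_intror erefl); rewrite !mulN1r opprB.
Qed.
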